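(* Let $P\subset\mathbb{R}^d$ be a full-dimensional centrally symmetric polytope (having the origin in its interior) and let $F,G$ be facets of $P$. Then $$\mathcal{B}_{F,G}=\operatorname{proj}\left((\operatorname{hom}(F)+(-\operatorname{hom}(G)))\cap\{x\in\mathbb{R}^{d+1}:x_{d+1}=0\}\right),$$ where $\operatorname{proj}:\mathbb{R}^{d+1}\to\mathbb{R}^d$ denotes the projection onto the first $d$ coordinates. Moreover, for any facet $F=\{x\in P: z^Tx=b\}$ of $P$ (where $z^Tx\le b$ is a valid inequality for $P$ defining the facet $F$), $$\mathcal{B}_{F,-F}=C_F\qquad\text{and}\qquad \mathcal{B}_{F,F}=\{x\in\mathbb{R}^d: z^Tx=0\}.$$ In particular, $\mathcal{B}_{F,G}$ is a non-empty polyhedral cone for all facets $F,G$ of $P$.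
   Context: $P=-P$ is a full-dimensional convex polytope in $\mathbb{R}^d$. Its distance function is $\operatorname{dist}(a,b)=\min\{\alpha\ge 0 : b-a\in\alpha P\}$. For $a,b\in\mathbb{R}^d$ the bisector is $\operatorname{bis}(a,b)=\{x\in\mathbb{R}^d:\operatorname{dist}(a,x)=\operatorname{dist}(b,x)\}$. For a facet $F$ of $P$, $C_F=\operatorname{cone}(F)$ is the set of all finite nonnegative linear combinations of points of $F$. For facets $F,G$, $\operatorname{bis}_{F,G}(a,b)=\operatorname{bis}(a,b)\cap(C_F+a)\cap(C_G+b)$. The bisection cone is $\mathcal{B}_{F,G}=\{x\in\mathbb{R}^d:\operatorname{bis}_{F,G}(0,x)\neq\emptyset\}$. For a polytope $Q\subset\mathbb{R}^d$, its homogenization is $\operatorname{hom}(Q)=\operatorname{cone}(Q\times\{1\})\subset\mathbb{R}^{d+1}$. Sums of sets are Minkowski sums. *)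

(* Defs.v *)
From mathcomp Require Import all_boot all_order all_algebra.
From mathcomp Require Import boolp classical_sets reals.

Set Implicit Arguments.
Unset Strict Implicit.
Unset Printing Implicit Defensive.

Import Order.TTheory GRing.Theory Num.Theory.

Local Open Scope classical_set_scope.
Local Open Scope ring_scope.

Section Convexity.
Variable R : realType.

Section FixedDimension.
Variable n : nat.
Implicit Types (S P F : set 'cV[R]_n) (z x : 'cV[R]_n) (b : R).

Definition dotv z x : R := (z^T *m x) 0 0.

Definition minkowski_sum (S1 S2 : set 'cV[R]_n) : set 'cV[R]_n :=
  [set x + y | x in S1 & y in S2].

Definition opp_set S : set 'cV[R]_n := [set - x | x in S].

Definition translate S (a : 'cV[R]_n) : set 'cV[R]_n := [set x + a | x in S].

(* [k = 0] is allowed, so that [cone set0] is [[set 0]]. *)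
Definition cone S : set 'cV[R]_n :=
  [set x | exists (k : nat) (c : 'I_k -> R) (v : 'I_k -> 'cV[R]_n),
     [/\ forall i, 0 <= c i, forall i, S (v i) & x = \sum_i c i *: v i]].

Definition convex_hull S : set 'cV[R]_n :=
  [set x | exists (k : nat) (c : 'I_k -> R) (v : 'I_k -> 'cV[R]_n),
     [/\ forall i, 0 <= c i, \sum_i c i = 1, forall i, S (v i)
       & x = \sum_i c i *: v i]].

Definition affine_hull S : set 'cV[R]_n :=
  [set x | exists (k : nat) (c : 'I_k -> R) (v : 'I_k -> 'cV[R]_n),
     [/\ \sum_i c i = 1, forall i, S (v i) & x = \sum_i c i *: v i]].

Definition polytope P : Prop :=
  exists V : seq 'cV[R]_n, P = convex_hull [set v | v \in V].

(* [S] is nonempty and its affine hull is [p + V] with [\dim V = k]; the empty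
   set has no dimension in this sense. *)
Definition has_dim S (k : nat) : Prop :=
  exists (p : 'cV[R]_n) (V : {vspace 'cV[R]_n}),
    \dim V = k /\ affine_hull S = [set p + v | v in [set v | v \in V]].

Definition full_dimensional S : Prop := has_dim S n.

Definition valid_inequality P z b : Prop := forall x, P x -> dotv z x <= b.

Definition face P z b : set 'cV[R]_n := [set x | P x /\ dotv z x = b].

Definition facet P F : Prop :=
  (exists z b, valid_inequality P z b /\ F = face P z b) /\
  (exists k, has_dim P k.+1 /\ has_dim F k).

Definition polyhedral_cone S : Prop :=
  exists (m : nat) (A : 'M[R]_(m, n)), S = [set x | forall i, (A *m x) i 0 <= 0].

Definition dilations P (a b : 'cV[R]_n) : set R :=
  [set t | 0 <= t /\ [set t *: p | p in P] (b - a)].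

(* The minimum of [dilations P a b]; the default value 0 is irrelevant when [P]
   is a full-dimensional polytope with [P = - P], as the minimum then exists. *)
Definition dist P (a b : 'cV[R]_n) : R :=
  xget 0 (dilations P a b `&` lbound (dilations P a b)).

Definition bis P (a b : 'cV[R]_n) : set 'cV[R]_n :=
  [set x | dist P a x = dist P b x].

Definition bis_facets P F G (a b : 'cV[R]_n) : set 'cV[R]_n :=
  bis P a b `&` translate (cone F) a `&` translate (cone G) b.

Definition bisection_cone P F G : set 'cV[R]_n :=
  [set x | bis_facets P F G 0 x !=set0].

End FixedDimension.

(* Points of R^(d+1) are block columns [col_mx x t] with [x] in R^d and [t] a
   1 x 1 block: [usubmx] is the projection onto the first [d] coordinates. *)
Definition homogenization d (Q : set 'cV[R]_d) : set 'cV[R]_(d + 1) :=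
  cone [set col_mx x (1%:M : 'cV[R]_1) | x in Q].

Definition proj d (y : 'cV[R]_(d + 1)) : 'cV[R]_d := usubmx y.

Definition last_coord d (y : 'cV[R]_(d + 1)) : R := y (rshift d 0) 0.

End Convexity.

(* Main.v *)
(* Since P = -P spans, a facet {z.x = b} of P has b > 0, so on the cone over a
   facet the distance to the origin is the linear function z.x / b, that is, the
   total weight of any conic combination of facet points representing x. Hence
   B_{F,G} consists of the differences u - w of points u in C_F and w in C_G of
   equal weight, which is the slice of hom(F) - hom(G) at height 0.
   For B_{F,F}, every direction x with z.x = 0 is a difference of two affine
   combinations of points of F, because aff(F) is a hyperplane; separating the
   positive from the negative coefficients turns it into such a difference u - w.
   If P is the hull of a finite set V, and V_F and V_G consist of the points of V
   on F and G, then F and G are their hulls, and B_{F,G} is the cone generated by V_F - V_G, since t (u - w) = sum a_i c_j (v_i - w_j) for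
   u = sum a_i v_i and w = sum c_j w_j of weight t; it is polyhedral by Weyl's
   theorem. *)

Require Import Defs.
From mathcomp Require Import all_boot all_order all_algebra.
From mathcomp Require Import boolp classical_sets reals.
From mathcomp Require Import lra.
Set Implicit Arguments.
Unset Strict Implicit.
Unset Printing Implicit Defensive.
Import Order.TTheory GRing.Theory Num.Theory.
Local Open Scope classical_set_scope.
Local Open Scope ring_scope.

(** * Linearity and definiteness of the dot product *)

Section DotProduct.
Variables (R : realType) (n : nat).
Implicit Types (x y z : 'cV[R]_n) (a : R).

Lemma dotvDr z x y : dotv z (x + y) = dotv z x + dotv z y.
Proof. by rewrite /dotv mulmxDr mxE. Qed.

Lemma dotvZr z a x : dotv z (a *: x) = a * dotv z x.
Proof. by rewrite /dotv -scalemxAr mxE. Qed.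

Lemma dotv0r z : dotv z 0 = 0.
Proof. by rewrite /dotv mulmx0 mxE. Qed.

Lemma dotvNr z x : dotv z (- x) = - dotv z x.
Proof. by rewrite /dotv mulmxN mxE. Qed.

Lemma dotvBr z x y : dotv z (x - y) = dotv z x - dotv z y.
Proof. by rewrite dotvDr dotvNr. Qed.

Lemma dotvDl z x y : dotv (x + y) z = dotv x z + dotv y z.
Proof. by rewrite /dotv linearD mulmxDl mxE. Qed.

Lemma dotvZl z a x : dotv (a *: x) z = a * dotv x z.
Proof. by rewrite /dotv linearZ -scalemxAl mxE. Qed.

Lemma dotvNl z x : dotv (- x) z = - dotv x z.
Proof. by rewrite /dotv linearN mulNmx mxE. Qed.

Lemma dotv_sum z k (c : 'I_k -> R) (v : 'I_k -> 'cV[R]_n) :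
  dotv z (\sum_i c i *: v i) = \sum_i c i * dotv z (v i).
Proof.
rewrite (big_morph (dotv z) (dotvDr z) (dotv0r z)).
by apply: eq_bigr => i _; rewrite dotvZr.
Qed.

Lemma dotv_delta i x : dotv (delta_mx i 0) x = x i 0.
Proof. by rewrite /dotv trmx_delta -rowE mxE. Qed.

Lemma dotvv_eq0 z : dotv z z = 0 -> z = 0.
Proof.
rewrite /dotv mxE => /psumr_eq0P z0; apply/matrixP => i j.
rewrite ord1 mxE; apply/eqP; rewrite -sqrf_eq0 expr2.
have := z0 (fun k _ => _) i isT; rewrite mxE => -> // k.
by rewrite mxE -expr2 sqr_ge0.
Qed.

End DotProduct.

(** * Conic combinations with their total weight, and cones *)

Section WeightedCombinations.
Variables (R : realType) (n : nat).
Implicit Types (S T : set 'cV[R]_n) (x y z : 'cV[R]_n) (a b t : R).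

(* [wcomb S x t] says that [(x, t)] lies in the homogenization of [S], without
   committing to block columns. *)
Definition wcomb S x t : Prop :=
  exists (k : nat) (c : 'I_k -> R) (v : 'I_k -> 'cV[R]_n),
    [/\ forall i, 0 <= c i, forall i, S (v i), x = \sum_i c i *: v i
      & t = \sum_i c i].

Lemma wcomb0 S : wcomb S 0 0.
Proof.
exists 0, (fun=> 0), (fun=> 0).
by split=> [[]|[]||]; rewrite ?big_ord0.
Qed.

Lemma wcomb_gen S x : S x -> wcomb S x 1.
Proof.
move=> Sx; exists 1, (fun=> 1), (fun=> x).
by split=> //; rewrite big_ord1 ?scale1r.
Qed.

Lemma wcombZ S a x t : 0 <= a -> wcomb S x t -> wcomb S (a *: x) (a * t).
Proof.
move=> a0 [k [c [v [c0 Sv -> ->]]]]; exists k, (fun i => a * c i), v.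
split=> // [i||]; first by rewrite mulr_ge0.
  by rewrite scaler_sumr; apply: eq_bigr => i _; rewrite scalerA.
by rewrite mulr_sumr.
Qed.

Lemma wcombD S x t y u : wcomb S x t -> wcomb S y u -> wcomb S (x + y) (t + u).
Proof.
move=> [k [c [v [c0 Sv -> ->]]]] [l [d [w [d0 Sw -> ->]]]].
exists (k + l)%N,
  (fun i => match split i with inl j => c j | inr j => d j end),
  (fun i => match split i with inl j => v j | inr j => w j end).
have E1 j : split (lshift l j) = inl j := unsplitK (inl _ j).
have E2 j : split (rshift k j) = inr j := unsplitK (inr _ j).
split=> [i|i||]; try by case: split.
- by rewrite big_split_ord; congr (_ + _); apply: eq_bigr => i _; rewrite (E1, E2).
- by rewrite big_split_ord; congr (_ + _); apply: eq_bigr => i _; rewrite (E1, E2).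
Qed.

(** Induction principle: [wcomb S] is the least convex cone of pairs that contains every [(x, 1)]
    with [x] in [S]. *)
Lemma wcomb_min S (C : 'cV[R]_n -> R -> Prop) :
  C 0 0 ->
  (forall x t y u, C x t -> C y u -> C (x + y) (t + u)) ->
  (forall a x t, 0 <= a -> C x t -> C (a *: x) (a * t)) ->
  (forall x, S x -> C x 1) ->
  forall x t, wcomb S x t -> C x t.
Proof.
move=> C0 CD CZ CS _ _ [k [c [v [c0 Sv -> ->]]]].
elim: k => [|k IH] in c v c0 Sv *; first by rewrite !big_ord0.
rewrite !big_ord_recl; apply: CD; last exact: IH.
by rewrite -[X in C _ X]mulr1; apply: CZ => //; exact: CS.
Qed.

Lemma wcomb_sub S T : (forall x, S x -> wcomb T x 1) ->
  forall x t, wcomb S x t -> wcomb T x t.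
Proof.
by move=> ST; apply: wcomb_min => //; [exact: wcomb0|exact: wcombD|exact: wcombZ].
Qed.

Lemma wcomb_weight_ge0 S x t : wcomb S x t -> 0 <= t.
Proof. by move=> [k [c [v [c0 _ _ ->]]]]; exact: sumr_ge0. Qed.

Lemma wcomb_weight0 S x : wcomb S x 0 -> x = 0.
Proof.
move=> [k [c [v [c0 _ -> /esym/psumr_eq0P c00]]]].
by apply: big1 => i _; rewrite c00 ?scale0r.
Qed.

(** For [b != 0] this determines the weight from the point, whatever combination represents it. *)
Lemma wcomb_dotv S z b x t : (forall y, S y -> dotv z y = b) ->
  wcomb S x t -> dotv z x = t * b.
Proof.
move=> zb [k [c [v [_ Sv -> ->]]]]; rewrite dotv_sum mulr_suml.
by apply: eq_bigr => i _; rewrite zb.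
Qed.

Lemma wcomb_opp S x t : wcomb (opp_set S) x t -> wcomb S (- x) t.
Proof.
move: x t; apply: wcomb_min => [|x t y u|a x t|_ [x Sx <-]].
- by rewrite oppr0; exact: wcomb0.
- by rewrite opprD; exact: wcombD.
- by rewrite -scalerN; exact: wcombZ.
- by rewrite opprK; exact: wcomb_gen.
Qed.

Lemma opp_setK S : opp_set (opp_set S) = S.
Proof.
apply/seteqP; split=> [_ [_ [x Sx <-] <-]|x Sx]; first by rewrite opprK.
by exists (- x); rewrite ?opprK //; exists x.
Qed.

Lemma cone_wcombP S x : cone S x <-> exists t, wcomb S x t.
Proof.
split=> [[k [c [v [c0 Sv ->]]]]|[t [k [c [v [c0 Sv -> _]]]]]].
  by exists (\sum_i c i), k, c, v.
by exists k, c, v.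
Qed.

Lemma convex_hull_wcombP S x : convex_hull S x <-> wcomb S x 1.
Proof. by split=> -[k [c [v [? ? ? ?]]]]; exists k, c, v. Qed.

Lemma cone_gen S x : S x -> cone S x.
Proof. by move=> Sx; apply/cone_wcombP; exists 1; exact: wcomb_gen. Qed.

Lemma cone0 S : cone S 0.
Proof. by apply/cone_wcombP; exists 0; exact: wcomb0. Qed.

Lemma coneD S x y : cone S x -> cone S y -> cone S (x + y).
Proof.
move=> /cone_wcombP[t xt] /cone_wcombP[u yu].
by apply/cone_wcombP; exists (t + u); exact: wcombD.
Qed.

Lemma coneZ S a x : 0 <= a -> cone S x -> cone S (a *: x).
Proof.
move=> a0 /cone_wcombP[t xt].
by apply/cone_wcombP; exists (a * t); exact: wcombZ.
Qed.

Lemma cone_min S (C : set 'cV[R]_n) :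
  C 0 -> (forall x y, C x -> C y -> C (x + y)) ->
  (forall a x, 0 <= a -> C x -> C (a *: x)) ->
  S `<=` C -> cone S `<=` C.
Proof.
move=> C0 CD CZ CS x /cone_wcombP[t]; move: x t.
by apply: (wcomb_min (C := fun x _ => C x)) => // [x _ y _|a x _]; [exact: CD|exact: CZ].
Qed.

(* Splitting the coefficients into positive and negative parts. *)
Lemma affine_hull_wcomb S x : affine_hull S x ->
  exists u w t s, [/\ wcomb S u t, wcomb S w s, x = u - w & t - s = 1].
Proof.
move=> [k [c [v [c1 Sv ->]]]].
exists (\sum_i Num.max (c i) 0 *: v i), (\sum_i Num.max (- c i) 0 *: v i).
exists (\sum_i Num.max (c i) 0), (\sum_i Num.max (- c i) 0).
have E i : c i = Num.max (c i) 0 - Num.max (- c i) 0.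
  by rewrite !maxEle; do 2![case: ifPn]; rewrite -?ltNge; lra.
split.
- by exists k, (fun i => Num.max (c i) 0), v; split=> // i; rewrite le_max lexx orbT.
- by exists k, (fun i => Num.max (- c i) 0), v; split=> // i; rewrite le_max lexx orbT.
- by rewrite -sumrB; apply: eq_bigr => i _; rewrite -scalerBl -E.
- by rewrite -c1 -sumrB; apply: eq_bigr => i _; rewrite -E.
Qed.

End WeightedCombinations.

Lemma homogenization_wcombP (R : realType) d (Q : set 'cV[R]_d) y :
  homogenization Q y <-> wcomb Q (proj y) (last_coord y).
Proof.
rewrite /proj /last_coord; split.
  pose C := [set y : 'cV[R]_(d + 1) | wcomb Q (usubmx y) (y (rshift d 0) 0)].
  apply: (cone_min (C := C)) y => [|x y|a x a0|_ [x Qx <-]]; rewrite /C /=.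
  - by rewrite linear0 mxE; exact: wcomb0.
  - by rewrite linearD mxE; exact: wcombD.
  - by rewrite linearZ mxE; exact: wcombZ.
  - by rewrite col_mxKu col_mxEd mxE; exact: wcomb_gen.
set x := usubmx y; set t := y _ _ => Qxt.
have -> : y = col_mx x t%:M.
  by rewrite -[LHS]vsubmxK; congr col_mx; apply/matrixP => i j; rewrite !ord1 !mxE.
elim/wcomb_min : Qxt => {y x t} [|x t y u xt yu|a x t a0 xt|x Qx].
- by rewrite raddf0 col_mx0; exact: cone0.
- by rewrite raddfD -add_col_mx; exact: coneD.
- by rewrite -scale_scalar_mx -scale_col_mx; exact: coneZ.
- by apply: cone_gen; exists x.
Qed.

(** * Weyl's theorem: finitely generated cones are polyhedral *)

Section Weyl.
Variables (R : realType) (n : nat).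
Implicit Types (s W : seq 'cV[R]_n) (x v : 'cV[R]_n).

(** The polar cone of the finite family [s]. *)
Definition halfspaces s : set 'cV[R]_n := [set x | forall a, a \in s -> dotv a x <= 0].

Lemma polyhedral_halfspaces s : polyhedral_cone (halfspaces s).
Proof.
exists (size s), (\matrix_(i < size s, j < n) (nth 0 s i) j 0).
have E i x : ((\matrix_(i < size s, j < n) (nth 0 s i) j 0) *m x) i 0 = dotv (nth 0 s i) x.
  by rewrite /dotv !mxE; apply: eq_bigr => j _; rewrite !mxE.
apply/seteqP; split=> x /= sx; first by move=> i; rewrite E; apply/sx/mem_nth.
by move=> a /(nthP 0)[i si <-]; rewrite -(E (Ordinal si)).
Qed.

Lemma halfspaces_zero : exists s, halfspaces s = [set 0].
Proof.
exists ([seq delta_mx i 0 | i <- enum 'I_n] ++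
  [seq - delta_mx i 0 | i <- enum 'I_n]).
apply/seteqP; split=> x /=; last first.
  by move=> -> a _; rewrite dotv0r.
move=> sx; apply/matrixP => i j; rewrite ord1 mxE; apply/eqP.
rewrite eq_le -oppr_le0 -dotv_delta -dotvNl.
by rewrite !sx // mem_cat ?(map_f (fun i => delta_mx i 0))
  ?(map_f (fun i => - delta_mx i 0)) ?mem_enum ?orbT.
Qed.

(* Fourier-Motzkin elimination of the coefficient of [v]. *)
Lemma halfspaces_add_ray s v : exists s',
  halfspaces s' = [set x | exists2 t, 0 <= t & halfspaces s (x - t *: v)].
Proof.
(* In the condition on [x - t *: v], an [a] with [dotv a v > 0] bounds [t] from below and one with
   [dotv a v < 0] bounds it from above. The kept inequalities make the upper bounds compatible with
   [0 <= t]; the positive combinations that cancel [v] make them compatible with the lower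
   bounds. *)
exists ([seq a <- s | dotv a v <= 0] ++
  [seq dotv p.1 v *: p.2 - dotv p.2 v *: p.1 |
     p <- [seq (a, b) | a <- [seq a <- s | 0 < dotv a v],
                        b <- [seq b <- s | dotv b v < 0]]]).
apply/seteqP; split=> x /=; last first.
  move=> [t t0 sx] a; rewrite mem_cat => /orP[|/mapP[_ /allpairsP[[p q] /= [+ + ->]] ->]].
    rewrite mem_filter => /andP[av /sx]; rewrite dotvBr dotvZr => ?.
    by have := mulr_ge0_le0 t0 av; lra.
  rewrite !mem_filter => /andP[pv /sx +] /andP[qv /sx].
  rewrite /= !dotvBr !dotvZr dotvDl dotvNl !dotvZl.
  by move: pv qv; set A := dotv p v; set B := dotv q v; nra.
move=> sx; pose low a := dotv a x / dotv a v.
(* The largest lower bound on [t]; the initial value 0 ensures [0 <= t]. *)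
exists (\big[Num.max/0]_(a <- s | 0 < dotv a v) low a).
  exact: bigmax_ge_id.
move=> a sa; rewrite dotvBr dotvZr subr_le0.
have [av|av|av] := ltgtP (dotv a v) 0.
- rewrite -ler_ndivlMr //; rewrite big_seq_cond.
  have ax : dotv a x <= 0 by apply: sx; rewrite mem_cat mem_filter sa ltW.
  apply: bigmax_le => [|b /andP[sb bv]]; first by rewrite mulr_le0 // invr_le0 ltW.
  have : dotv (dotv b v *: a - dotv a v *: b) x <= 0.
    apply: sx; rewrite mem_cat; apply/orP; right; apply/mapP; exists (b, a) => //.
    by apply/allpairsP; exists (b, a); rewrite !mem_filter bv av sa sb.
  rewrite dotvDl dotvNl !dotvZl /low ler_ndivlMr // mulrAC ler_pdivlMr //; lra.
- rewrite -ler_pdivrMr //; exact: (@le_bigmax_seq _ _ _ _ _ _ _ low).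
- by rewrite av mulr0; apply: sx; rewrite mem_cat mem_filter sa av lexx.
Qed.

(** Induction on the generators: start from the zero cone and add one ray at a time. *)
Lemma polyhedral_finitely_generated W : polyhedral_cone (cone [set w | w \in W]).
Proof.
suff [s <-] : exists s, halfspaces s = cone [set w | w \in W].
  exact: polyhedral_halfspaces.
elim: W => [|v W [s sW]].
  have [s s0] := halfspaces_zero; exists s; rewrite s0; apply/esym/seteqP; split=> [|_ ->].
    by apply: cone_min => //= [_ _ -> ->|a _ _ ->]; rewrite ?addr0 ?scaler0.
  exact: cone0.
have [s' s'E] := halfspaces_add_ray s v; exists s'; rewrite s'E sW {s s' sW s'E}.
apply/esym/seteqP; split.
  apply: cone_min => /= [|x y [t t0 xt] [u u0 yu]|a x a0 [t t0 xt]|w /=].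
  - by exists 0 => //; rewrite scale0r subr0; exact: cone0.
  - by exists (t + u); rewrite ?addr_ge0 // scalerDl opprD addrACA; exact: coneD.
  - by exists (a * t); rewrite ?mulr_ge0 // -scalerA -scalerBr; exact: coneZ.
  - rewrite inE => /orP[/eqP ->|wW].
      by exists 1 => //; rewrite scale1r subrr; exact: cone0.
    by exists 0 => //; rewrite scale0r subr0; exact: cone_gen.
move=> x [t t0 xt]; rewrite -[x](subrK (t *: v)); apply: coneD.
  apply: cone_min xt; [exact: cone0|exact: coneD|exact: coneZ|move=> w /= wW].
  by apply: cone_gen; rewrite /= inE wW orbT.
by apply/coneZ/cone_gen => //=; rewrite inE eqxx.
Qed.

End Weyl.

(** * Affine hulls and dimension *)

Section Dimension.
Variables (R : realType) (n : nat).
Implicit Types (S P F : set 'cV[R]_n) (z x : 'cV[R]_n) (b : R).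

(** The direction space is recovered from the affine hull as the set of differences of its
    points. *)
Lemma has_dim_uniq S k l : has_dim S k -> has_dim S l -> k = l.
Proof.
move=> [p [V [<- SpV]]] [q [W [<- SqW]]].
have pVqW := etrans (esym SpV) SqW.
suff sub (p' q' : 'cV[R]_n) (V' W' : {vspace 'cV[R]_n}) :
    [set p' + v | v in [set v | v \in V']] = [set q' + v | v in [set v | v \in W']] ->
    (V' <= W')%VS.
  have -> : V = W; last by [].
  by apply/eqP; rewrite eqEsubv (sub _ _ _ _ pVqW) (sub _ _ _ _ (esym pVqW)).
move=> E; apply/subvP => v vV.
have : [set p' + v | v in [set v | v \in V']] (p' + v) by exists v.
have : [set p' + v | v in [set v | v \in V']] p'.
  by exists 0; rewrite /= ?mem0v ?addr0.
rewrite E => -[w wW <-] [w' w'W /eqP].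
by rewrite -addrA (inj_eq (addrI _)) addrC -subr_eq => /eqP <-; exact: rpredB.
Qed.

Lemma has_dim_nonempty S k : has_dim S k -> S !=set0.
Proof.
move=> [p [V [_ SpV]]].
have : affine_hull S p by rewrite SpV; exists 0; rewrite /= ?mem0v ?addr0.
move=> [[|m] [c [v [c1 Sv _]]]]; last by exists (v ord0).
by move: c1 => /eqP; rewrite big_ord0 eq_sym oner_eq0.
Qed.

Lemma affine_hull_dotv S z b x : (forall y, S y -> dotv z y = b) ->
  affine_hull S x -> dotv z x = b.
Proof.
move=> zb [k [c [v [c1 Sv ->]]]].
rewrite dotv_sum -[RHS]mul1r -c1 mulr_suml.
by apply: eq_bigr => i _; rewrite zb.
Qed.

End Dimension.

(** * Distances on facet cones, and bisection cones *)

Section Facets.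
Variables (R : realType) (n : nat) (P : set 'cV[R]_n).
Implicit Types (F G : set 'cV[R]_n) (x y z u w : 'cV[R]_n) (b t : R).

Lemma polytope_wcomb x : polytope P -> wcomb P x 1 -> P x.
Proof.
move=> [V ->] Px; apply/convex_hull_wcombP.
by apply: wcomb_sub Px => y /convex_hull_wcombP.
Qed.

Lemma polytope_dilation x t : polytope P -> P !=set0 -> wcomb P x t ->
  [set t *: p | p in P] x.
Proof.
move=> polP [p Pp] xt; have [t0|t0] := eqVneq t 0.
  by exists p => //; rewrite t0 scale0r; rewrite t0 in xt; rewrite (wcomb_weight0 xt).
exists (t^-1 *: x); last by rewrite scalerA divff // scale1r.
apply: polytope_wcomb => //; rewrite -[X in wcomb _ _ X](mulVf t0).
by apply: wcombZ => //; rewrite invr_ge0; exact: wcomb_weight_ge0 xt.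
Qed.

(** The combination itself puts [x - a] in [t *: P], while the valid inequality gives
    [t * b = dotv z (x - a) <= s * b] for every other dilation factor [s]. *)
Lemma dist_face_wcomb z b a x t : polytope P -> P !=set0 ->
  valid_inequality P z b -> 0 < b -> wcomb (face P z b) (x - a) t ->
  dist P a x = t.
Proof.
move=> polP P0 zb b0 xt.
have xb : dotv z (x - a) = t * b by apply: wcomb_dotv xt => y [].
have t0 := wcomb_weight_ge0 xt.
have tle s : dilations P a x s -> t <= s.
  move=> [s0 [p /zb pb spE]]; rewrite -(ler_pM2r b0) -xb -spE dotvZr.
  exact: ler_wpM2l.
have tP : dilations P a x t.
  split=> //; apply: polytope_dilation => //.
  by apply: wcomb_sub xt => y [Py _]; exact: wcomb_gen.
apply: xget_unique => [//|s [sP sle]].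
by apply/eqP; rewrite eq_le sle //= tle.
Qed.

Lemma face_opp z b : P = opp_set P -> opp_set (face P z b) = face P (- z) b.
Proof.
move=> symP; apply/seteqP; split=> [_ [x [Px zx] <-]|x [Px zx]].
  by split; [rewrite symP; exists x|rewrite dotvNr dotvNl opprK].
exists (- x); last by rewrite opprK.
split; last by rewrite dotvNr -dotvNl.
by move: Px; rewrite {1}symP => -[y Py <-]; rewrite opprK.
Qed.

Lemma valid_opp z b : P = opp_set P -> valid_inequality P z b ->
  valid_inequality P (- z) b.
Proof.
move=> symP zb x; rewrite symP => -[y /zb yb <-].
by rewrite dotvNr dotvNl opprK.
Qed.

(** By symmetry both [z] and [- z] are bounded by [b] on [P]. If [b <= 0], then [dotv z] equals [b]
    on all of [P], so [F = P], against the dimensions. *)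
Lemma facet_bound_gt0 F z b : P = opp_set P -> facet P F ->
  valid_inequality P z b -> F = face P z b -> 0 < b.
Proof.
move=> symP [_ [k [dP dF]]] zb FE; rewrite ltNge; apply/negP => b_le0.
suff FP : F = P by rewrite FP in dF; have := has_dim_uniq dP dF; elim: (k) => // ? + [].
rewrite FE; apply/seteqP; split=> [x []//|x Px]; split=> //.
have := valid_opp symP zb Px; have := zb _ Px; rewrite dotvNl; lra.
Qed.

(** The direction space [V] of [F] has codimension 1 and is orthogonal to [z]. If [x] were outside
    it, [V + <[x]>] would be the whole space and orthogonal to [z], forcing [z = 0] and hence
    [b = 0]. *)
Lemma facet_direction F z b x : full_dimensional P -> facet P F -> 0 < b ->
  F = face P z b -> dotv z x = 0 ->
  exists2 p, affine_hull F p & affine_hull F (p + x).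
Proof.
move=> fullP [_ [k [dP dF]]] b0 FE zx.
have kn := has_dim_uniq dP fullP.
have zF y : F y -> dotv z y = b by rewrite FE => -[].
have [f Ff] := has_dim_nonempty dF.
case: dF => p [V [dV affF]].
have affp : affine_hull F p by rewrite affF; exists 0; rewrite /= ?mem0v ?addr0.
have zV v : v \in V -> dotv z v = 0.
  move=> vV; have : affine_hull F (p + v) by rewrite affF; exists v.
  move=> /(affine_hull_dotv zF); rewrite dotvDr (affine_hull_dotv zF affp); lra.
exists p => //; rewrite affF; exists x => //=; apply: contraT => xV.
have V_lt : (\dim V < \dim (V + <[x]>))%N.
  by rewrite (ltn_leqif (dimv_leqif_sup (addvSl V <[x]>))) subv_add subvv -memvE.
have VxT : (V + <[x]>)%VS = fullv.
  apply/eqP; rewrite eqEdim subvf; apply: leq_trans V_lt.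
  by rewrite dV kn dimvf /dim /= muln1.
have : z \in fullv by exact: memvf.
rewrite -VxT => /memv_addP[v vV [_ /vlineP[c ->] zE]].
have z0 : z = 0.
  by apply: dotvv_eq0; rewrite {2}zE dotvDr dotvZr zV // zx mulr0 addr0.
by have := zF _ Ff; rewrite z0 -[0](scale0r 0) dotvZl mul0r => b0'; rewrite -b0' ltxx in b0.
Qed.

(** A bisector point is [u] seen from 0 and [w] seen from [x], and its two distances are the weights
    of [u] and [w]. Stating this for faces with positive bounds lets it apply to [opp_set F] without
    proving that it is a facet. *)
Lemma mem_bisection_cone z1 b1 z2 b2 x : polytope P -> P !=set0 ->
  valid_inequality P z1 b1 -> 0 < b1 -> valid_inequality P z2 b2 -> 0 < b2 ->
  bisection_cone P (face P z1 b1) (face P z2 b2) x <->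
  exists u w t,
    [/\ wcomb (face P z1 b1) u t, wcomb (face P z2 b2) w t & x = u - w].
Proof.
move=> polP P0 v1 b1_gt0 v2 b2_gt0.
have dist1 a y t := @dist_face_wcomb z1 b1 a y t polP P0 v1 b1_gt0.
have dist2 a y t := @dist_face_wcomb z2 b2 a y t polP P0 v2 b2_gt0.
split.
  move=> [y [[byx [u /cone_wcombP[t ut] uE]] [w /cone_wcombP[s ws] wE]]].
  exists u, w, t; split=> //; last by rewrite -[u]addr0 uE -wE addrC addKr.
  have <- : s = t; last by [].
  move: byx; rewrite /bis /= (dist1 _ _ t); last by rewrite -uE addrK.
  by rewrite (dist2 _ _ s) // -wE addrK.
move=> [u [w [t [ut wt ->]]]]; exists u; split; first split.
- by rewrite /bis /= (dist1 _ _ t) ?subr0 // (dist2 _ _ t) // opprB addrC subrK.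
- by exists u; rewrite ?addr0 //; apply/cone_wcombP; exists t.
- by exists w; [apply/cone_wcombP; exists t|rewrite addrC subrK].
Qed.

Lemma mem_bisection_cone_facets F G x : polytope P -> P !=set0 ->
  P = opp_set P -> facet P F -> facet P G ->
  bisection_cone P F G x <->
  exists u w t, [/\ wcomb F u t, wcomb G w t & x = u - w].
Proof.
move=> polP P0 symP fF fG.
have [[zF [bF [vF FE]]] _] := fF; have [[zG [bG [vG GE]]] _] := fG.
have bF0 := facet_bound_gt0 symP fF vF FE.
have bG0 := facet_bound_gt0 symP fG vG GE.
rewrite FE GE; exact: mem_bisection_cone.
Qed.

(** A combination of generators that attains the bound puts positive coefficients only on generators
    that attain it. *)
Lemma face_convex_hull (V : seq 'cV[R]_n) z b x :
  valid_inequality P z b -> P = convex_hull [set v | v \in V] -> face P z b x ->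
  wcomb [set v | v \in [seq v <- V | dotv z v == b]] x 1.
Proof.
move=> zb PV [Px zx].
have V_le v : v \in V -> dotv z v <= b.
  by move=> vV; apply: zb; rewrite PV; apply/convex_hull_wcombP/wcomb_gen.
(* The inequality is carried along so that equality for a sum forces equality for both summands. *)
pose C y t := dotv z y <= t * b /\
  (dotv z y = t * b -> wcomb [set v | v \in [seq v <- V | dotv z v == b]] y t).
suff /(_ x 1)[| _] : forall y t, wcomb [set v | v \in V] y t -> C y t.
- by apply/convex_hull_wcombP; rewrite -PV.
- by apply; rewrite mul1r.
apply: wcomb_min => [|y t u s [yt Cy] [us Cu]|a y t a0 [yt Cy]|v /= vV].
- by split; rewrite ?dotv0r ?mul0r // => _; exact: wcomb0.
- split; rewrite dotvDr mulrDl; first exact: lerD.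
  by move=> E; apply: wcombD; [apply: Cy|apply: Cu]; lra.
- split; rewrite dotvZr -mulrA; first exact: ler_wpM2l.
  have [->|an0] := eqVneq a 0; first by rewrite scale0r !mul0r => _; exact: wcomb0.
  by move=> /(mulfI an0) /Cy; exact: wcombZ.
- split; rewrite mul1r; first exact: V_le.
  by move=> /eqP zv; apply: wcomb_gen; rewrite /= mem_filter zv vV.
Qed.

Lemma cone_differences (V W : seq 'cV[R]_n) x :
  cone [set d | d \in [seq v - w | v <- V, w <- W]] x <->
  exists u w t, [/\ wcomb [set v | v \in V] u t, wcomb [set v | v \in W] w t & x = u - w].
Proof.
set D := [set d | _ \in _]; split.
  pose C := [set x | exists u w t,
    [/\ wcomb [set v | v \in V] u t, wcomb [set v | v \in W] w t & x = u - w]].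
  apply: (cone_min (C := C)) x => [|x y|a x a0|d].
  - by exists 0, 0, 0; rewrite subr0; split; try exact: wcomb0.
  - move=> [u [w [t [ut wt ->]]]] [u' [w' [t' [ut' wt' ->]]]].
    by exists (u + u'), (w + w'), (t + t'); rewrite opprD addrACA; split; try exact: wcombD.
  - move=> [u [w [t [ut wt ->]]]].
    by exists (a *: u), (a *: w), (a * t); rewrite scalerBr; split; try exact: wcombZ.
  - move=> /allpairsP[[v w] /= [vV wW ->]].
    by exists v, w, 1; split=> //; exact: wcomb_gen.
have D1 v : v \in V -> forall w s, wcomb [set v | v \in W] w s -> cone D (s *: v - w).
  move=> vV; apply: wcomb_min => [|w s w' s' ws ws'|a w s a0 ws|w wW].
  - by rewrite scale0r subr0; exact: cone0.
  - by rewrite scalerDl opprD addrACA; exact: coneD.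
  - by rewrite -scalerA -scalerBr; exact: coneZ.
  - by rewrite scale1r; apply: cone_gen; exact: allpairs_f.
(* Scaling each point by the weight of the other makes the expression bilinear in the pairs [(u, t)]
   and [(w, s)], so the two inductions run separately. The case [s = t] gives [t *: (u - w)]. *)
have D2 u t : wcomb [set v | v \in V] u t ->
    forall w s, wcomb [set v | v \in W] w s -> cone D (s *: u - t *: w).
  move: u t; apply: wcomb_min => [|u t u' t' Cu Cu'|a u t a0 Cu|v vV] w s ws.
  - by rewrite scaler0 scale0r subr0; exact: cone0.
  - by rewrite scalerDl scalerDr opprD addrACA; apply: coneD; [exact: Cu|exact: Cu'].
  - by rewrite scalerA [s * a]mulrC -!scalerA -scalerBr; apply: coneZ => //; exact: Cu.
  - by rewrite scale1r; exact: D1.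
move=> [u [w [t [ut wt ->]]]]; have [t0|tn0] := eqVneq t 0.
  rewrite t0 in ut wt.
  by rewrite (wcomb_weight0 ut) (wcomb_weight0 wt) subr0; exact: cone0.
rewrite -[u - w]scale1r -(mulVf tn0) -scalerA scalerBr; apply: coneZ.
  by rewrite invr_ge0; exact: wcomb_weight_ge0 wt.
exact: D2.
Qed.

Lemma bisection_cone_finitely_generated F G : polytope P -> P !=set0 ->
  P = opp_set P -> facet P F -> facet P G ->
  exists W : seq 'cV[R]_n, bisection_cone P F G = cone [set w | w \in W].
Proof.
move=> polP P0 symP fF fG; case: (polP) => V PV.
have gen H : facet P H -> exists W : seq 'cV[R]_n,
    forall x t, wcomb H x t <-> wcomb [set w | w \in W] x t.
  move=> [[z [b [zb HE]]] _]; exists [seq v <- V | dotv z v == b] => x t; split.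
    apply: wcomb_sub => y; rewrite HE; exact: face_convex_hull.
  apply: wcomb_sub => y; rewrite /= mem_filter => /andP[/eqP zy yV].
  apply: wcomb_gen; rewrite HE; split=> //; rewrite PV.
  by apply/convex_hull_wcombP/wcomb_gen.
have [VF VFE] := gen F fF; have [VG VGE] := gen G fG.
exists [seq v - w | v <- VF, w <- VG]; apply/seteqP; split=> x.
  move=> /mem_bisection_cone_facets[]// u [w [t [/VFE ut /VGE wt xE]]].
  by apply/cone_differences; exists u, w, t.
move=> /cone_differences[u [w [t [/VFE ut /VGE wt xE]]]].
by apply/mem_bisection_cone_facets => //; exists u, w, t.
Qed.

End Facets.

Theorem proposition3p1 (R : realType) (d : nat) (P : set 'cV[R]_d)
    (polP : polytope P) (fullP : full_dimensional P) (symP : P = opp_set P) :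
  [/\ forall F G : set 'cV[R]_d, facet P F -> facet P G ->
        bisection_cone P F G =
        [set proj y | y in minkowski_sum (homogenization F) (opp_set (homogenization G))
                           `&` [set y | last_coord y = 0]],
      forall (F : set 'cV[R]_d) (z : 'cV[R]_d) (b : R), facet P F ->
        valid_inequality P z b -> F = face P z b ->
        bisection_cone P F (opp_set F) = cone F /\
        bisection_cone P F F = [set x | dotv z x = 0]
    & forall F G : set 'cV[R]_d, facet P F -> facet P G ->
        bisection_cone P F G !=set0 /\ polyhedral_cone (bisection_cone P F G)].
Proof.
have P0 := has_dim_nonempty fullP.
split.
- move=> F G fF fG; apply/seteqP; split=> x.
    move=> /mem_bisection_cone_facets[]// u [w [t [ut wt ->]]].
    have lift Q y : wcomb Q y t -> homogenization Q (col_mx y (t%:M : 'cV_1)).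
      move=> yt; apply/homogenization_wcombP.
      by rewrite /proj /last_coord col_mxKu col_mxEd mxE mulr1n.
    exists (col_mx u t%:M - col_mx w t%:M).
      split; last by rewrite /last_coord /= mxE [X in _ + X]mxE !col_mxEd subrr.
      exists (col_mx u t%:M); first exact: lift.
      by exists (- col_mx w t%:M) => //; exists (col_mx w t%:M) => //; exact: lift.
    by rewrite /proj linearB /= !col_mxKu.
  move=> [_ [[y /homogenization_wcombP Fy [_ [w /homogenization_wcombP Gw <-] <-]] yw0] <-].
  apply/mem_bisection_cone_facets => //.
  exists (proj y), (proj w), (last_coord y); split=> //; last by rewrite /proj linearB.
  have -> : last_coord y = last_coord w; last by [].
  by apply/eqP; rewrite -subr_eq0; move: yw0; rewrite /last_coord /= !mxE => ->.
- move=> F z b fF zb FE.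
  have b0 := facet_bound_gt0 symP fF zb FE.
  have zF y : F y -> dotv z y = b by rewrite FE => -[].
  have memFN x : bisection_cone P F (opp_set F) x <->
      exists u w t, [/\ wcomb F u t, wcomb (opp_set F) w t & x = u - w].
    by rewrite FE face_opp //; apply: mem_bisection_cone => //; exact: valid_opp.
  split; apply/seteqP; split=> x.
  + move=> /memFN[u [w [t [ut /wcomb_opp wt ->]]]].
    by apply/cone_wcombP; exists (t + t); exact: wcombD.
  + move=> /cone_wcombP[t xt]; apply/memFN.
    have h : 0 <= 2^-1 :> R by rewrite invr_ge0.
    (* Halving [x] gives opposite points of equal weight in the cones of [F] and [opp_set F]; their
       difference is [x]. *)
    exists (2^-1 *: x), (- (2^-1 *: x)), (2^-1 * t); split; first exact: wcombZ.
      by apply: wcomb_opp; rewrite opp_setK; exact: wcombZ.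
    by rewrite opprK -scalerDl -[LHS]scale1r; congr (_ *: _); lra.
  + move=> /mem_bisection_cone_facets[]// u [w [t [ut wt ->]]] /=.
    by rewrite dotvBr (wcomb_dotv zF ut) (wcomb_dotv zF wt) subrr.
  + move=> /= zx; have [p pF pxF] := facet_direction fullP fF b0 FE zx.
    apply/mem_bisection_cone_facets => //.
    have [u [w [t [s [ut ws pE ts]]]]] := affine_hull_wcomb pF.
    have [u' [w' [t' [s' [ut' ws' pxE ts']]]]] := affine_hull_wcomb pxF.
    (* Subtracting [p = u - w] from [p + x = u' - w'] gives [x = (u' + w) - (u + w')]; the weights
       agree because [t - s] and [t' - s'] are both 1. *)
    exists (u' + w), (u + w'), (t' + s); split; first exact: wcombD.
      by rewrite (_ : t' + s = t + s'); [exact: wcombD|lra].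
    by rewrite [u + w']addrC opprD addrACA -pxE -[w - u]opprB -pE addrAC subrr add0r.
- move=> F G fF fG.
  have [W ->] := bisection_cone_finitely_generated polP P0 symP fF fG.
  by split; [exists 0; exact: cone0|exact: polyhedral_finitely_generated].
Qed.
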